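(* Let $(C,\alpha)$ be a hom-vector space, i.e. a vector space $C$ over $\mathbb{K}$ with a linear map $\alpha:C\to C$. The collection of vector spaces $\{C^n_{\alpha,\mathrm{coDend}}(C,C)\}_{n\ge1}$ forms a (nonsymmetric) operad with partial compositions $$(\sigma\bullet_i\tau)([r];-)=\big((\alpha^{n-1})^{\otimes(i-1)}\otimes\tau(R_i(m;1,\dots,n,\dots,1)[r];-)\otimes(\alpha^{n-1})^{\otimes(m-i)}\big)\circ\sigma(R_0(m;1,\dots,n,\dots,1)[r];-)$$ for $\sigma\in C^m_{\alpha,\mathrm{coDend}}(C,C)$, $\tau\in C^n_{\alpha,\mathrm{coDend}}(C,C)$, $1\le i\le m$, $[r]\in C_{m+n-1}$, and identity element $\mathrm{id}\in C^1_{\alpha,\mathrm{coDend}}(C,C)$ given by $\mathrm{id}([1];c)=c$ for all $c\in C$. Moreover, the collection of maps $\{\Phi_n:C^n_{\alpha,\mathrm{coDend}}(C,C)\to C^n_{\alpha,\mathrm{coAss}}(C,C)\}_{n\ge1}$ given by $$\Phi_n(\sigma)=\sigma([1];-)+\cdots+\sigma([n];-)$$ is a morphism of operads.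
   Context: $\mathbb{K}$ is a field of characteristic zero; all spaces and maps are over $\mathbb{K}$. Let $C_n=\{[1],\dots,[n]\}$ (a set of labels, not to be confused with the vector space $C$) and let $\mathbb{K}[C_n]$ be the vector space with basis $C_n$. For $m,n\ge1$, $1\le i\le m$, the maps $R_0=R_0(m;1,\dots,n,\dots,1):C_{m+n-1}\to C_m$ and $R_i=R_i(m;1,\dots,n,\dots,1):C_{m+n-1}\to\mathbb{K}[C_n]$ (with $n$ in the $i$-th place) are: $R_0[r]=[r]$ if $r\le i-1$, $R_0[r]=[i]$ if $i\le r\le i+n-1$, $R_0[r]=[r-n+1]$ if $i+n\le r\le m+n-1$; and $R_i[r]=[r-(i-1)]$ if $i\le r\le i+n-1$, $R_i[r]=[1]+\cdots+[n]$ otherwise. For $n\ge1$, $C^n_{\alpha,\mathrm{coDend}}(C,C)$ is the space of linear maps $\sigma:\mathbb{K}[C_n]\otimes C\to C^{\otimes n}$ with $\alpha^{\otimes n}(\sigma([r];c))=\sigma([r];\alpha(c))$ for all $[r]\in C_n$, $c\in C$. For $n\ge1$, $C^n_{\alpha,\mathrm{coAss}}(C,C)$ is the space of linear maps $\sigma:C\to C^{\otimes n}$ with $\alpha^{\otimes n}\circ\sigma=\sigma\circ\alpha$. These form a nonsymmetric operad with identity $\mathrm{id}_C$ and partial compositions $\sigma\bullet_i\tau=((\alpha^{n-1})^{\otimes(i-1)}\otimes\tau\otimes(\alpha^{n-1})^{\otimes(m-i)})\circ\sigma$ for $\sigma$ of arity $m$, $\tau$ of arity $n$, $1\le i\le m$.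 A (nonsymmetric) operad is a collection of vector spaces $\mathcal{O}(n)$, $n\ge1$, with bilinear partial compositions $\bullet_i:\mathcal{O}(m)\otimes\mathcal{O}(n)\to\mathcal{O}(m+n-1)$, $1\le i\le m$, such that for $f\in\mathcal{O}(m)$, $g\in\mathcal{O}(n)$, $h\in\mathcal{O}(p)$: $(f\bullet_i g)\bullet_{i+j-1}h=f\bullet_i(g\bullet_j h)$ for $1\le i\le m$, $1\le j\le n$; $(f\bullet_i g)\bullet_{j+n-1}h=(f\bullet_j h)\bullet_i g$ for $1\le i<j\le m$; and an element $\mathrm{id}\in\mathcal{O}(1)$ with $f\bullet_i\mathrm{id}=f=\mathrm{id}\bullet_1f$. A morphism of operads is a collection of linear maps preserving arities, partial compositions and identities. *)

(* Defs.v *)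
From HB Require Import structures.
From mathcomp Require Import all_boot all_order all_algebra.
From mathcomp Require Import boolp functions.
From mathcomp Require Import zify.
From mathcomp.multinomials Require Import freeg.

Set Implicit Arguments.
Unset Strict Implicit.
Unset Printing Implicit Defensive.

Import GRing.Theory Quotient.
Local Open Scope ring_scope.
Local Open Scope quotient_scope.

Section QuotientModule.
Variables (K : fieldType) (V : lmodType K) (R : V -> Prop).

(* The submodule generated by R, as the smallest one containing R. *)
Definition gen_submod : {pred V} := fun v => `[< forall P : V -> Prop,
  P 0 -> (forall a u w, P u -> P w -> P (a *: u + w)) ->
  (forall r, R r -> P r) -> P v >].

Lemma gen_submodP v : reflect (forall P : V -> Prop,
  P 0 -> (forall a u w, P u -> P w -> P (a *: u + w)) ->
  (forall r, R r -> P r) -> P v) (v \in gen_submod).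
Proof. exact: asboolP. Qed.

Lemma gen_submod_closed : submod_closed gen_submod.
Proof.
split=> [|a u v /gen_submodP uR /gen_submodP vR]; apply/gen_submodP => P //.
by move=> P0 PZ PR; apply: (PZ); [exact: uR | exact: vR].
Qed.
HB.instance Definition _ :=
  GRing.isSubmodClosed.Build K V gen_submod gen_submod_closed.

Definition quot_mod := {quot gen_submod}.
HB.instance Definition _ := GRing.Zmodule.on quot_mod.

Definition quot_pi (v : V) : quot_mod := \pi_{quot gen_submod} v.

Lemma quot_pi_zmod : zmod_morphism quot_pi.
Proof. exact: pi_is_zmod_morphism. Qed.
HB.instance Definition _ :=
  GRing.isZmodMorphism.Build V quot_mod quot_pi quot_pi_zmod.

Lemma quot_piP u v : reflect (quot_pi u = quot_pi v) (u - v \in gen_submod).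
Proof. by rewrite Quotient.idealrBE; apply: eqP. Qed.

Lemma quot_pi_repr (q : quot_mod) : quot_pi (repr q) = q.
Proof. exact: reprK. Qed.

Definition quot_scale (a : K) (q : quot_mod) := quot_pi (a *: repr q).

Lemma quot_scale_pi a v : quot_scale a (quot_pi v) = quot_pi (a *: v).
Proof.
by apply/quot_piP; rewrite -scalerBr rpredZ //; apply/quot_piP/quot_pi_repr.
Qed.

Lemma quot_scaleA a b q :
  quot_scale a (quot_scale b q) = quot_scale (a * b) q.
Proof. by rewrite -(quot_pi_repr q) !quot_scale_pi scalerA. Qed.

Lemma quot_scale1 : left_id 1 quot_scale.
Proof. by move=> q; rewrite -(quot_pi_repr q) quot_scale_pi scale1r. Qed.

Lemma quot_scaleDr : right_distributive quot_scale +%R.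
Proof.
move=> a p q; rewrite -(quot_pi_repr p) -(quot_pi_repr q).
by rewrite -raddfD !quot_scale_pi scalerDr raddfD.
Qed.

Lemma quot_scaleDl q : {morph quot_scale^~ q : a b / a + b}.
Proof.
by move=> a b; rewrite -(quot_pi_repr q) !quot_scale_pi scalerDl raddfD.
Qed.

HB.instance Definition _ := GRing.Zmodule_isLmodule.Build K quot_mod
  quot_scaleA quot_scale1 quot_scaleDr quot_scaleDl.

Lemma quot_pi_linear : linear quot_pi.
Proof. by move=> a u v; rewrite raddfD /= -quot_scale_pi. Qed.

Lemma quot_pi_eq u v : R (u - v) -> quot_pi u = quot_pi v.
Proof. by move=> Ruv; apply/quot_piP/gen_submodP => P _ _; exact. Qed.

(* The map induced on the quotient by f : V -> W; meaningful when f is linear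
   and vanishes on R. *)
Definition quot_lift (W : lmodType K) (f : V -> W) (q : quot_mod) := f (repr q).

Lemma quot_lift_pi (W : lmodType K) (f : V -> W) :
  linear f -> (forall r, R r -> f r = 0) ->
  forall v, quot_lift f (quot_pi v) = f v.
Proof.
move=> lf fR v; pose F := GRing.isLinear.Build _ _ _ _ f lf.
pose g : {linear V -> W} := HB.pack f F.
apply/eqP; rewrite -[f]/(g : _ -> _) /quot_lift -subr_eq0 -raddfB /=.
have /quot_piP/gen_submodP : quot_pi (repr (quot_pi v)) = quot_pi v.
  exact: quot_pi_repr.
move=> /(_ (fun x => g x = 0)) g0; apply/eqP/g0 => //; first exact: raddf0.
by move=> a u w gu gw; rewrite linearP gu gw scaler0 addr0.
Qed.

Lemma quot_lift_linear (W : lmodType K) (f : V -> W) :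
  linear f -> (forall r, R r -> f r = 0) -> linear (quot_lift f).
Proof.
move=> lf fR a p q; rewrite -(quot_pi_repr p) -(quot_pi_repr q).
by rewrite -quot_pi_linear !quot_lift_pi ?lf.
Qed.
End QuotientModule.
(* Opaque, here and below, only to keep unification from unfolding quotients. *)
Global Opaque quot_lift quot_pi.

Section FreeLift.
Variables (K : fieldType) (X : choiceType) (W : lmodType K) (f : X -> W).

Lemma fglift_linear : linear (fglift f : {freeg X / K} -> W).
Proof.
pose G := GRing.isZmodMorphism.Build _ _ (fglift f : {freeg X / K} -> W)
  (lift_is_additive f).
pose g : {additive {freeg X / K} -> W} := HB.pack (fglift f) G.
move=> a u v; rewrite -[fglift f]/(g : _ -> _) raddfD; congr (_ + _).
rewrite -[a *: u]/(fgscale a u) /fgscale (raddf_sum g).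
rewrite -[in RHS](freeg_sumE u) (raddf_sum g).
rewrite scaler_sumr; apply: eq_bigr => x _ /=.
by rewrite !liftU scalerA.
Qed.

Lemma fgliftU1 x : fglift f << x >> = f x.
Proof. by rewrite liftU scale1r. Qed.

End FreeLift.

Lemma freeg_lin_ind (K : fieldType) (X : choiceType) (P : {freeg X / K} -> Prop) :
  P 0 -> (forall a u v, P u -> P v -> P (a *: u + v)) ->
  (forall x, P << x >>) -> forall u, P u.
Proof.
move=> P0 PZ PX u; rewrite -(freeg_sumE u).
elim/big_rec: _ => // x v _ Pv.
suff -> : << coeff x u *g x >> = coeff x u *: << x >> :> {freeg X / K}.
  exact: PZ.
by apply/eqP/freeg_eqP => y; rewrite coeffZ !coeffU mul1r.
Qed.

Section TensorProduct.
Variables (K : fieldType) (V W : lmodType K).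

Inductive tensor_rel : {freeg (V * W)%type / K} -> Prop :=
| tensor_rel_l a v v' w :
    tensor_rel (<< (a *: v + v', w) >> - (a *: << (v, w) >> + << (v', w) >>))
| tensor_rel_r a v w w' :
    tensor_rel (<< (v, a *: w + w') >> - (a *: << (v, w) >> + << (v, w') >>)).

Definition tensor : lmodType K := quot_mod tensor_rel.

Definition tens (v : V) (w : W) : tensor := quot_pi tensor_rel << (v, w) >>.

Definition bilinear_map (U : lmodType K) (f : V -> W -> U) :=
  (forall w, linear (f^~ w)) /\ (forall v, linear (f v)).

Lemma tens_bilinear : bilinear_map tens.
Proof.
split=> [w a v v'|v a w w']; rewrite /tens -quot_pi_linear.
  exact/quot_pi_eq/tensor_rel_l.
exact/quot_pi_eq/tensor_rel_r.
Qed.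

Lemma tens_linear_l a v v' w :
  tens (a *: v + v') w = a *: tens v w + tens v' w.
Proof. exact: (tens_bilinear.1 w). Qed.

Lemma tens_linear_r a v w w' :
  tens v (a *: w + w') = a *: tens v w + tens v w'.
Proof. exact: (tens_bilinear.2 v). Qed.

Definition tensor_lift (U : lmodType K) (f : V -> W -> U) : tensor -> U :=
  quot_lift (fglift (fun x => f x.1 x.2)).

Section Lift.
Variables (U : lmodType K) (f : V -> W -> U).
Hypothesis bf : bilinear_map f.

Let f_rel r : tensor_rel r -> fglift (fun x => f x.1 x.2) r = 0.
Proof.
have fN := lift_is_additive (fun x : V * W => f x.1 x.2).
case: bf => fl fr; case=> [a v v' w|a v w w'];
  rewrite fN fglift_linear !fgliftU1 /=.
  by rewrite (fl w) subrr.
by rewrite (fr v) subrr.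
Qed.

Lemma tensor_lift_tens v w : tensor_lift f (tens v w) = f v w.
Proof.
by rewrite /tensor_lift quot_lift_pi ?fgliftU1 //; exact: fglift_linear.
Qed.

Lemma tensor_lift_linear : linear (tensor_lift f).
Proof. by apply: quot_lift_linear => //; exact: fglift_linear. Qed.
End Lift.

Lemma tensor_ind (P : tensor -> Prop) :
  P 0 -> (forall a x y, P x -> P y -> P (a *: x + y)) ->
  (forall v w, P (tens v w)) -> forall x, P x.
Proof.
move=> P0 PZ Pt x; rewrite -(quot_pi_repr x).
move: (repr x); apply: freeg_lin_ind => [|a u v Pu Pv|[v w]]; last exact: Pt.
  by rewrite raddf0.
by rewrite quot_pi_linear; exact: PZ.
Qed.
End TensorProduct.
Global Opaque tensor tens tensor_lift.

Section TensorPower.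
Variables (K : fieldType) (C : lmodType K).
Implicit Types (n : nat).

Definition tset n (t : n.-tuple C) (i : 'I_n) (x : C) : n.-tuple C :=
  [tuple if j == i then x else tnth t j | j < n].

Inductive tpow_rel n : {freeg (n.-tuple C) / K} -> Prop :=
| TpowRel (t : n.-tuple C) i a x y :
    tpow_rel (<< tset t i (a *: x + y) >>
              - (a *: << tset t i x >> + << tset t i y >>)).

(* tpow n is the n-fold tensor power of C, and pure [tuple c_1; ..; c_n] is
   c_1 (x) ... (x) c_n. *)
Definition tpow n : lmodType K := quot_mod (@tpow_rel n).

Definition pure n (t : n.-tuple C) : tpow n := quot_pi (@tpow_rel n) << t >>.

Definition multilinear_map n (W : lmodType K) (f : n.-tuple C -> W) :=
  forall (t : n.-tuple C) i, linear (fun x => f (tset t i x)).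

Lemma pure_multilinear n : multilinear_map (@pure n).
Proof.
move=> t i a x y; rewrite /pure -quot_pi_linear.
exact/quot_pi_eq/TpowRel.
Qed.

Definition tpow_lift n (W : lmodType K) (f : n.-tuple C -> W) : tpow n -> W :=
  quot_lift (fglift f).

Section Lift.
Variables (n : nat) (W : lmodType K) (f : n.-tuple C -> W).
Hypothesis mf : multilinear_map f.

Let f_rel r : tpow_rel r -> fglift f r = 0.
Proof.
have fN := lift_is_additive f.
by case=> t i a x y; rewrite fN fglift_linear !fgliftU1 mf subrr.
Qed.

Lemma tpow_lift_pure t : tpow_lift f (pure t) = f t.
Proof.
by rewrite /tpow_lift quot_lift_pi ?fgliftU1 //; exact: fglift_linear.
Qed.

Lemma tpow_lift_linear : linear (tpow_lift f).
Proof. by apply: quot_lift_linear => //; exact: fglift_linear. Qed.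
End Lift.

Lemma tpow_ind n (P : tpow n -> Prop) :
  P 0 -> (forall a u v, P u -> P v -> P (a *: u + v)) ->
  (forall t, P (pure t)) -> forall u, P u.
Proof.
move=> P0 PZ Pt u; rewrite -(quot_pi_repr u).
move: (repr u); apply: freeg_lin_ind => [|a v w Pv Pw|t]; last exact: Pt.
  by rewrite raddf0.
by rewrite quot_pi_linear; exact: PZ.
Qed.

Global Opaque tpow pure tpow_lift.

Lemma tpow_ext n (W : lmodType K) (f g : tpow n -> W) :
  linear f -> linear g -> (forall t, f (pure t) = g (pure t)) -> f =1 g.
Proof.
have l0 (h : tpow n -> W) : linear h -> h 0 = 0.
  by move=> lh; have := lh (-1) 0 0; rewrite scaler0 addr0 scaleN1r addNr.
move=> lf lg fg; apply: tpow_ind => //; first by rewrite !l0.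
by move=> a u v fgu fgv; rewrite lf lg fgu fgv.
Qed.

Definition tcast m n (e : m = n) (u : tpow m) : tpow n :=
  ecast k (tpow k) e u.

Lemma tcast_linear m n (e : m = n) : linear (tcast e).
Proof. by case: n / e. Qed.

Lemma nth_tset n (t : n.-tuple C) (i : 'I_n) x (j : nat) :
  (tset t i x)`_j = if j == i then x else t`_j.
Proof.
have [lt_jn|le_nj] := ltnP j n; last first.
  rewrite !nth_default ?size_tuple //.
  by case: eqP le_nj => // ->; rewrite leqNgt ltn_ord.
by rewrite -(tnth_nth _ _ (Ordinal lt_jn)) tnth_mktuple -(tnth_nth 0 t (Ordinal lt_jn)).
Qed.

Lemma eq_tuple_nth n (s t : n.-tuple C) :
  (forall j, (j < n)%N -> s`_j = t`_j) -> s = t.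
Proof.
by move=> st; apply: eq_from_tnth => i; rewrite !(tnth_nth 0) st.
Qed.

(* The map u |-> v |-> u (x) v from C^a x C^b to C^(a+b), i.e. concatenation
   of pure tensors. *)
Definition tmul a b (u : tpow a) (v : tpow b) : tpow (a + b) :=
  tpow_lift (fun s => tpow_lift (fun t => pure (cat_tuple s t)) v) u.

Lemma nth_cat_tuple a b (s : a.-tuple C) (t : b.-tuple C) (j : nat) :
  (cat_tuple s t)`_j = if (j < a)%N then s`_j else t`_(j - a).
Proof. by rewrite nth_cat size_tuple. Qed.

Lemma cat_tset_l a b (s : a.-tuple C) (t : b.-tuple C) i x :
  cat_tuple (tset s i x) t = tset (cat_tuple s t) (lshift b i) x.
Proof.
apply: eq_tuple_nth => j _; rewrite nth_tset !nth_cat_tuple nth_tset.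
by case: ltnP => // le_aj; case: eqP le_aj => // ->; rewrite /= leqNgt ltn_ord.
Qed.

Lemma cat_tset_r a b (s : a.-tuple C) (t : b.-tuple C) i x :
  cat_tuple s (tset t i x) = tset (cat_tuple s t) (rshift a i) x.
Proof.
apply: eq_tuple_nth => j _; rewrite nth_tset !nth_cat_tuple nth_tset.
case: ltnP => [lt_ja|le_aj]; last by rewrite -(eqn_add2l a) subnKC.
by case: eqP lt_ja => // ->; rewrite /= ltnNge leq_addr.
Qed.

Let mulr_multilinear a b (s : a.-tuple C) :
  multilinear_map (fun t : b.-tuple C => pure (cat_tuple s t)).
Proof. by move=> t i c x y; rewrite !cat_tset_r pure_multilinear. Qed.

Let mull_multilinear a b (v : tpow b) : multilinear_map
  (fun s : a.-tuple C => tpow_lift (fun t => pure (cat_tuple s t)) v).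
Proof.
move=> s i c x y; move: v; apply: tpow_ext.
- exact/tpow_lift_linear/mulr_multilinear.
- move=> d u v; rewrite !tpow_lift_linear; try exact: mulr_multilinear.
  by rewrite !scalerDr !scalerA (mulrC c) addrACA.
- by move=> t; rewrite !tpow_lift_pure ?cat_tset_l ?pure_multilinear;
    try exact: mulr_multilinear.
Qed.

Lemma tmul_pure a b (s : a.-tuple C) (t : b.-tuple C) :
  tmul (pure s) (pure t) = pure (cat_tuple s t).
Proof. by rewrite /tmul !tpow_lift_pure. Qed.

Lemma tmul_linear_l a b c (u u' : tpow a) (v : tpow b) :
  tmul (c *: u + u') v = c *: tmul u v + tmul u' v.
Proof. exact: (tpow_lift_linear (mull_multilinear v)). Qed.

Lemma tmul_linear_r a b c (u : tpow a) (v v' : tpow b) :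
  tmul u (c *: v + v') = c *: tmul u v + tmul u v'.
Proof.
move: u; apply: tpow_ext => [d u u'|d u u'|s]; first exact: tmul_linear_l.
  by rewrite !tmul_linear_l !scalerDr !scalerA (mulrC c) addrACA.
rewrite /tmul !(tpow_lift_pure (mull_multilinear _)).
exact/tpow_lift_linear/mulr_multilinear.
Qed.

Definition tpow_map (f : C -> C) n : tpow n -> tpow n :=
  tpow_lift (fun t => pure (map_tuple f t)).

Section TensorMap.
Variable f : C -> C.
Hypothesis lf : linear f.

Let map_multilinear n :
  multilinear_map (fun t : n.-tuple C => pure (map_tuple f t)).
Proof.
have E t i x : map_tuple f (tset t i x) = tset (map_tuple f t) i (f x) :> n.-tuple C.
  apply: eq_from_tnth => j; rewrite tnth_map !tnth_mktuple tnth_map.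
  by case: eqP.
by move=> t i a x y; rewrite !E lf pure_multilinear.
Qed.

Lemma tpow_map_pure n (t : n.-tuple C) :
  tpow_map f (pure t) = pure (map_tuple f t).
Proof. exact: tpow_lift_pure. Qed.

Lemma tpow_map_linear n : linear (@tpow_map f n).
Proof. exact: tpow_lift_linear. Qed.

Lemma tpow_map_tcast m n (e : m = n) u :
  tpow_map f (tcast e u) = tcast e (tpow_map f u).
Proof. by case: n / e. Qed.

Lemma tpow_map_tmul a b (u : tpow a) (v : tpow b) :
  tpow_map f (tmul u v) = tmul (tpow_map f u) (tpow_map f v).
Proof.
move: u; apply: tpow_ext => [c x y|c x y|s].
- by rewrite tmul_linear_l tpow_map_linear.
- by rewrite tpow_map_linear tmul_linear_l.
move: v; apply: tpow_ext => [c x y|c x y|t].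
- by rewrite tmul_linear_r tpow_map_linear.
- by rewrite tpow_map_linear tmul_linear_r.
rewrite !(tpow_map_pure, tmul_pure); congr pure.
by apply: val_inj; rewrite /= map_cat.
Qed.
End TensorMap.

Lemma tpow_insert_arity m n (i : 'I_m) :
  (i + n + (m - i.+1) = (m + n).-1)%N.
Proof.
have := ltn_ord i; lia.
Qed.

Lemma nth_mktuple_nat k (F : nat -> C) (j : nat) :
  (j < k)%N -> [tuple F l | l < k]`_j = F j.
Proof. by move=> jk; rewrite -(tnth_nth _ _ (Ordinal jk)) tnth_mktuple. Qed.

Section Insert.
Variables (m n : nat) (i : 'I_m) (f : C -> C) (g : C -> tpow n).

(* With i counted from 0: the linear map
   f^(x)i (x) g (x) f^(x)(m-i-1) : C^(x)m -> C^(x)(m+n-1). *)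
Definition tpow_insert_pure (t : m.-tuple C) : tpow (m + n).-1 :=
  tcast (tpow_insert_arity n i)
    (tmul (tmul (pure [tuple f t`_j | j < i]) (g t`_i))
          (pure [tuple f t`_(i.+1 + j) | j < m - i.+1])).

Definition tpow_insert : tpow m -> tpow (m + n).-1 :=
  tpow_lift tpow_insert_pure.

Hypotheses (lf : linear f) (lg : linear g).

Lemma tpow_insert_multilinear : multilinear_map tpow_insert_pure.
Proof.
move=> t k a x y; rewrite /tpow_insert_pure -tcast_linear; congr tcast.
have [lt_ki|lt_ik|eq_ki] := ltngtP k i.
- have L z : [tuple f (tset t k z)`_j | j < i] =
      tset [tuple f t`_j | j < i] (Ordinal lt_ki) (f z).
    apply: eq_tuple_nth => j ji; rewrite nth_tset.
    rewrite (nth_mktuple_nat (fun j => f t`_j)) //.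
    by rewrite (nth_mktuple_nat (fun j => f (tset t k z)`_j)) // nth_tset /=; case: eqP.
  have R z : [tuple f (tset t k z)`_(i.+1 + j) | j < m - i.+1] =
      [tuple f t`_(i.+1 + j) | j < m - i.+1].
    apply: eq_from_tnth => j; rewrite !tnth_mktuple nth_tset.
    by case: eqP => // e; have := lt_ki; lia.
  rewrite !L !R !nth_tset (gtn_eqF lt_ki) lf pure_multilinear.
  by rewrite !(tmul_linear_l, tmul_linear_r).
- have kj : (k - i.+1 < m - i.+1)%N by have := ltn_ord k; lia.
  have R z : [tuple f (tset t k z)`_(i.+1 + j) | j < m - i.+1] =
      tset [tuple f t`_(i.+1 + j) | j < m - i.+1] (Ordinal kj) (f z).
    apply: eq_tuple_nth => j ji; rewrite nth_tset.
    rewrite (nth_mktuple_nat (fun j => f t`_(i.+1 + j))) //.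
    rewrite (nth_mktuple_nat (fun j => f (tset t k z)`_(i.+1 + j))) //.
    rewrite nth_tset /=.
    have -> : (i.+1 + j == k)%N = (j == k - i.+1)%N by lia.
    by case: eqP.
  have L z : [tuple f (tset t k z)`_j | j < i] = [tuple f t`_j | j < i].
    apply: eq_from_tnth => j; rewrite !tnth_mktuple nth_tset.
    by case: eqP => // e; have := ltn_ord j; lia.
  rewrite !L !R !nth_tset (ltn_eqF lt_ik) lf pure_multilinear.
  by rewrite !(tmul_linear_l, tmul_linear_r).
- have L z : [tuple f (tset t k z)`_j | j < i] = [tuple f t`_j | j < i].
    apply: eq_from_tnth => j; rewrite !tnth_mktuple nth_tset.
    by case: eqP => // e; have := ltn_ord j; lia.
  have R z : [tuple f (tset t k z)`_(i.+1 + j) | j < m - i.+1] =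
      [tuple f t`_(i.+1 + j) | j < m - i.+1].
    apply: eq_from_tnth => j; rewrite !tnth_mktuple nth_tset.
    by case: eqP => // e; have := eq_ki; lia.
  rewrite !L !R !nth_tset -eq_ki eqxx lg.
  by rewrite !(tmul_linear_l, tmul_linear_r).
Qed.

Lemma tpow_insertE (t : m.-tuple C) : tpow_insert (pure t) =
  tcast (tpow_insert_arity n i)
    (tmul (tmul (pure [tuple f t`_j | j < i]) (g t`_i))
          (pure [tuple f t`_(i.+1 + j) | j < m - i.+1])).
Proof. exact/tpow_lift_pure/tpow_insert_multilinear. Qed.

Lemma tpow_insert_linear : linear tpow_insert.
Proof. exact/tpow_lift_linear/tpow_insert_multilinear. Qed.

Lemma tpow_insert_map (alpha : C -> C) (lalpha : linear alpha) :
  (forall c, alpha (f c) = f (alpha c)) ->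
  (forall c, tpow_map alpha (g c) = g (alpha c)) ->
  forall u, tpow_map alpha (tpow_insert u) = tpow_insert (tpow_map alpha u).
Proof.
move=> fE gE; apply: tpow_ext => [a x y|a x y|t].
- by rewrite tpow_insert_linear tpow_map_linear.
- by rewrite tpow_map_linear // tpow_insert_linear.
rewrite tpow_map_pure // !tpow_insertE tpow_map_tcast !tpow_map_tmul //.
rewrite gE !tpow_map_pure // (nth_map 0) ?size_tuple //.
congr (tcast _ (tmul (tmul (pure _) _) (pure _))).
  apply: eq_from_tnth => j; rewrite tnth_map !tnth_mktuple fE.
  by rewrite (nth_map 0) // size_tuple (ltn_trans (ltn_ord j)).
apply: eq_from_tnth => j; rewrite tnth_map !tnth_mktuple fE.
by rewrite (nth_map 0) // size_tuple; have := ltn_ord j; lia.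
Qed.
End Insert.
End TensorPower.

(* O(0) plays no role: every axiom below is restricted to positive arities.
   Positions are counted from 0, so op_comp O i is the partial composition
   usually written with index i + 1. *)
Record operad_data (K : fieldType) := OperadData {
  op_space :> nat -> lmodType K;
  op_comp : forall m n, 'I_m -> op_space m -> op_space n -> op_space (m + n).-1;
  op_id : op_space 1
}.
Arguments op_comp {K} _ {m n}.

(* Equality of elements whose arities are equal but not convertible. *)
Definition op_eq (K : fieldType) (O : operad_data K) m n (x : O m) (y : O n) :=
  Tagged (fun k => O k : Type) x = Tagged (fun k => O k : Type) y.
Arguments op_eq {K} O {m n}.

Record is_operad (K : fieldType) (O : operad_data K) : Prop := IsOperad {
  op_linear_l : forall m n (i : 'I_m) (g : O n), (0 < n)%N ->
    linear (fun f : O m => op_comp O i f g);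
  op_linear_r : forall m n (i : 'I_m) (f : O m), (0 < n)%N ->
    linear (fun g : O n => op_comp O i f g);
  op_assoc : forall m n p (i : 'I_m) (j : 'I_n) (k : 'I_(m + n).-1)
      (f : O m) (g : O n) (h : O p), (0 < p)%N -> k = (i + j)%N :> nat ->
    op_eq O (op_comp O k (op_comp O i f g) h)
            (op_comp O i f (op_comp O j g h));
  (* (j + 1) + n - 1 counted from 1 is (j + n) - 1 counted from 0. *)
  op_parallel : forall m n p (i j : 'I_m)
      (k : 'I_(m + n).-1) (l : 'I_(m + p).-1)
      (f : O m) (g : O n) (h : O p), (0 < n)%N -> (0 < p)%N -> (i < j)%N ->
    k = (j + n).-1 :> nat -> l = i :> nat ->
    op_eq O (op_comp O k (op_comp O i f g) h)
            (op_comp O l (op_comp O j f h) g);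
  op_idr : forall m (i : 'I_m) (f : O m), op_eq O (op_comp O i f (op_id O)) f;
  op_idl : forall n (f : O n), (0 < n)%N ->
    op_eq O (op_comp O ord0 (op_id O) f) f
}.

Record is_operad_morphism (K : fieldType) (O P : operad_data K)
    (phi : forall n, O n -> P n) : Prop := IsOperadMorphism {
  opm_linear : forall n, (0 < n)%N -> linear (phi n);
  opm_comp : forall m n (i : 'I_m) (f : O m) (g : O n), (0 < n)%N ->
    phi _ (op_comp O i f g) = op_comp P i (phi m f) (phi n g);
  opm_id : phi 1%N (op_id O) = op_id P
}.

Arguments is_operad_morphism {K} O P phi.

Section Labels.
Variable K : fieldType.

(* C_n is 'I_n, the label [r] being the ordinal r - 1, and K[C_n] is 'rV[K]_n. *)
Definition label n (r : 'I_n) : 'rV[K]_n := delta_mx 0 r.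

Lemma R0_subproof m n (i : 'I_m) (r : 'I_(m + n).-1) :
  ((if r < i then r : nat else if r < i + n then i : nat else r - n.-1) < m)%N.
Proof.
have := ltn_ord i; have := ltn_ord r.
by case: (ltnP r i) => ?; [|case: (ltnP r (i + n)) => ?]; lia.
Qed.

Definition R0 m n (i : 'I_m) (r : 'I_(m + n).-1) : 'I_m :=
  Ordinal (R0_subproof i r).

Lemma Ri_subproof m n (i : 'I_m) (r : 'I_(m + n).-1) :
  (i <= r < i + n)%N -> (r - i < n)%N.
Proof. lia. Qed.

Definition Ri m n (i : 'I_m) (r : 'I_(m + n).-1) : 'rV[K]_n :=
  if @idP (i <= r < i + n)%N is ReflectT ir
  then label (Ordinal (Ri_subproof ir)) else \sum_(s < n) label s.
End Labels.
Arguments R0 {m} n i r.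
Arguments Ri K {m} n i r.

Section Cochains.
Variables (K : fieldType) (C : lmodType K) (alpha : {linear C -> C}).

Lemma iter_linear k : linear (iter k alpha).
Proof. by elim: k => [|k IH] a x y //=; rewrite IH linearP. Qed.

Lemma iter_comm k c : alpha (iter k alpha c) = iter k alpha (alpha c).
Proof. by rewrite -iterS iterSr. Qed.

Section CoAss.
Variable n : nat.

Definition coAss_pred : {pred C -> tpow C n} := fun sigma =>
  `[< linear sigma /\ forall c, tpow_map alpha (sigma c) = sigma (alpha c) >].

Lemma coAss_predP sigma : reflect
  (linear sigma /\ forall c, tpow_map alpha (sigma c) = sigma (alpha c))
  (sigma \in coAss_pred).
Proof. exact: asboolP. Qed.

Lemma coAss_pred_closed : submod_closed coAss_pred.
Proof.
have mL := @tpow_map_linear _ C alpha (linearP alpha) n.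
split=> [|a s t /coAss_predP[ls es] /coAss_predP[lt et]]; apply/coAss_predP.
  split=> [a x y|c] /=; first by rewrite scaler0 addr0.
  by have := mL (-1) 0 0; rewrite scaler0 addr0 scaleN1r addNr.
split=> [b x y|c] /=; rewrite !addrfctE !scalrfctE; last by rewrite mL es et.
by rewrite ls lt !scalerDr !scalerA (mulrC a) addrACA.
Qed.
HB.instance Definition _ :=
  GRing.isSubmodClosed.Build K (C -> tpow C n) coAss_pred coAss_pred_closed.

Record coAss := CoAss {
  coAss_val :> C -> tpow C n;
  _ : coAss_val \in coAss_pred }.
HB.instance Definition _ := [isSub for coAss_val].
HB.instance Definition _ := [Choice of coAss by <:].
HB.instance Definition _ := [SubChoice_isSubLmodule of coAss by <:].

Lemma coAss_linear (sigma : coAss) : linear sigma.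
Proof. by case: sigma => s /= /coAss_predP[]. Qed.

Lemma coAss_equivariant (sigma : coAss) c :
  tpow_map alpha (sigma c) = sigma (alpha c).
Proof. by case: sigma => s /= /coAss_predP[]. Qed.
End CoAss.
Arguments coAss_pred : clear implicits.

Section CoDend.
Variable n : nat.
Local Notation dom := (tensor 'rV[K]_n C).

Definition coDend_pred : {pred dom -> tpow C n} := fun sigma =>
  `[< linear sigma /\ forall (r : 'I_n) c,
      tpow_map alpha (sigma (tens (label K r) c)) =
      sigma (tens (label K r) (alpha c)) >].

Lemma coDend_predP sigma : reflect
  (linear sigma /\ forall (r : 'I_n) c,
      tpow_map alpha (sigma (tens (label K r) c)) =
      sigma (tens (label K r) (alpha c)))
  (sigma \in coDend_pred).
Proof. exact: asboolP. Qed.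

Lemma coDend_pred_closed : submod_closed coDend_pred.
Proof.
have mL := @tpow_map_linear _ C alpha (linearP alpha) n.
split=> [|a s t /coDend_predP[ls es] /coDend_predP[lt et]]; apply/coDend_predP.
  split=> [a x y|r c] /=; first by rewrite scaler0 addr0.
  by have := mL (-1) 0 0; rewrite scaler0 addr0 scaleN1r addNr.
split=> [b x y|r c] /=; rewrite !addrfctE !scalrfctE; last by rewrite mL es et.
by rewrite ls lt !scalerDr !scalerA (mulrC a) addrACA.
Qed.
HB.instance Definition _ :=
  GRing.isSubmodClosed.Build K (dom -> tpow C n) coDend_pred coDend_pred_closed.

Record coDend := CoDend {
  coDend_val :> dom -> tpow C n;
  _ : coDend_val \in coDend_pred }.
HB.instance Definition _ := [isSub for coDend_val].
HB.instance Definition _ := [Choice of coDend by <:].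
HB.instance Definition _ := [SubChoice_isSubLmodule of coDend by <:].

Lemma coDend_linear (sigma : coDend) : linear sigma.
Proof. by case: sigma => s /= /coDend_predP[]. Qed.

(* sigma([r]; -) commutes with alpha for all labels, hence on all of K[C_n]. *)
Lemma coDend_equivariant (sigma : coDend) x c :
  tpow_map alpha (sigma (tens x c)) = sigma (tens x (alpha c)).
Proof.
have mL := @tpow_map_linear _ C alpha (linearP alpha) n.
have sL := coDend_linear sigma.
have tL := (tens_bilinear 'rV[K]_n C).1.
have z (U W : lmodType K) (h : U -> W) : linear h -> h 0 = 0.
  by move=> lh; have := lh (-1) 0 0; rewrite scaler0 addr0 scaleN1r addNr.
rewrite [x]row_sum_delta; elim/big_rec: _ => [|r y _ IH].
  by rewrite !(z _ _ _ (tL _)) !(z _ _ _ sL) (z _ _ _ mL).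
rewrite !tL !sL mL IH; congr (_ *: _ + _).
by case: sigma {sL IH} => s /= /coDend_predP[_ ->].
Qed.
End CoDend.
Arguments coDend_pred : clear implicits.

Section CoAssOperad.
Variables (m n : nat) (i : 'I_m) (sigma : coAss m) (tau : coAss n).

Let comp_fun (c : C) : tpow C (m + n).-1 :=
  tpow_insert i (iter n.-1 alpha) tau (sigma c).

Lemma coAss_comp_subproof : comp_fun \in coAss_pred (m + n).-1.
Proof.
apply/coAss_predP; split=> [a x y|c]; rewrite /comp_fun.
  rewrite coAss_linear; apply: tpow_insert_linear; first exact: iter_linear.
  exact: coAss_linear.
rewrite -coAss_equivariant; apply: tpow_insert_map.
- exact: iter_linear.
- exact: coAss_linear.
- exact: linearP.
- exact: iter_comm.
- exact: coAss_equivariant.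
Qed.

Definition coAss_comp : coAss (m + n).-1 := CoAss coAss_comp_subproof.
End CoAssOperad.

Lemma coAss_id_subproof : (fun c => pure [tuple c]) \in coAss_pred 1.
Proof.
have tE c : [tuple c] = tset [tuple 0] ord0 c :> 1.-tuple C.
  by apply: eq_from_tnth => j; rewrite tnth_mktuple !ord1 tnth0 eqxx.
apply/coAss_predP; split=> [a x y|c].
  by rewrite (tE (_ + _)) (tE x) (tE y); exact: pure_multilinear.
rewrite tpow_map_pure; last exact: linearP.
by congr pure; apply: val_inj.
Qed.

Lemma pure1_bij : bijective (fun c : C => pure [tuple c]).
Proof.
have mf : multilinear_map (fun t : 1.-tuple C => tnth t ord0).
  by move=> t i a x y; rewrite !tnth_mktuple !ord1 eqxx.
have lf := tpow_lift_linear mf.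
exists (tpow_lift (fun t : 1.-tuple C => tnth t ord0)) => [c|].
  by rewrite tpow_lift_pure.
have /coAss_predP[l1 _] := coAss_id_subproof.
apply: (tpow_ext (f := fun u => pure [tuple tpow_lift _ u]) (g := id)) => //.
  by move=> a x y; rewrite lf l1.
move=> t; rewrite tpow_lift_pure //; congr pure.
by apply: eq_from_tnth => j; rewrite !ord1.
Qed.

(* The identity of C, through the identification of C with its first tensor
   power given by pure1_bij. *)
Definition coAss_id : coAss 1 := CoAss coAss_id_subproof.

Definition coAss_operad : operad_data K :=
  OperadData (op_space := fun n => coAss n : lmodType K) coAss_comp coAss_id.

Section CoDendOperad.
Variables (m n : nat) (i : 'I_m) (sigma : coDend m) (tau : coDend n).

Definition coDend_comp_label (r : 'I_(m + n).-1) (c : C) : tpow C (m + n).-1 :=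
  tpow_insert i (iter n.-1 alpha) (fun d => tau (tens (Ri K n i r) d))
    (sigma (tens (label K (R0 n i r)) c)).

Let comp_fun : tensor 'rV[K]_(m + n).-1 C -> tpow C (m + n).-1 :=
  tensor_lift (fun (x : 'rV[K]_(m + n).-1) c =>
    \sum_r x 0 r *: coDend_comp_label r c).

Let tau_linear x : linear (fun d => tau (tens x d)).
Proof. by move=> a c d; rewrite tens_linear_r coDend_linear. Qed.

Let label_linear r : linear (coDend_comp_label r).
Proof.
move=> a c d; rewrite /coDend_comp_label tens_linear_r coDend_linear.
by apply: tpow_insert_linear; [exact: iter_linear | exact: tau_linear].
Qed.

Let comp_bilinear :
  bilinear_map (fun (x : 'rV[K]_(m + n).-1) c =>
    \sum_r x 0 r *: coDend_comp_label r c).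
Proof.
split=> [c a x y|x a c d]; rewrite scaler_sumr -big_split;
  apply: eq_bigr => r _ /=.
  by rewrite !mxE scalerDl scalerA.
by rewrite label_linear scalerDr !scalerA mulrC.
Qed.

Let comp_funE r c : comp_fun (tens (label K r) c) = coDend_comp_label r c.
Proof.
rewrite /comp_fun (tensor_lift_tens comp_bilinear) (bigD1 r) //= big1.
  by rewrite addr0 mxE !eqxx scale1r.
by move=> s sr; rewrite mxE (negbTE sr) andbF scale0r.
Qed.

Lemma coDend_comp_subproof : comp_fun \in coDend_pred (m + n).-1.
Proof.
apply/coDend_predP; split=> [|r c].
  exact: (tensor_lift_linear comp_bilinear).
rewrite !comp_funE /coDend_comp_label -coDend_equivariant.
apply: tpow_insert_map.
- exact: iter_linear.
- exact: tau_linear.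
- exact: linearP.
- exact: iter_comm.
- by move=> d; exact: coDend_equivariant.
Qed.

Definition coDend_comp : coDend (m + n).-1 := CoDend coDend_comp_subproof.

Lemma coDend_compE r c : coDend_comp (tens (label K r) c) =
  tpow_insert i (iter n.-1 alpha) (fun d => tau (tens (Ri K n i r) d))
    (sigma (tens (label K (R0 n i r)) c)).
Proof. exact: comp_funE. Qed.
End CoDendOperad.

Let id_fun : tensor 'rV[K]_1 C -> tpow C 1 :=
  tensor_lift (fun (x : 'rV[K]_1) c => x 0 0 *: coAss_id c).

Let id_bilinear : bilinear_map (fun (x : 'rV[K]_1) c => x 0 0 *: coAss_id c).
Proof.
split=> [c a x y|x a c d]; first by rewrite !mxE scalerDl scalerA.
by rewrite coAss_linear scalerDr !scalerA mulrC.
Qed.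

Let id_funE r c : id_fun (tens (label K r) c) = coAss_id c.
Proof.
by rewrite /id_fun (tensor_lift_tens id_bilinear) mxE !ord1 eqxx scale1r.
Qed.

Lemma coDend_id_subproof : id_fun \in coDend_pred 1.
Proof.
apply/coDend_predP; split=> [|r c].
  exact: (tensor_lift_linear id_bilinear).
by rewrite !id_funE coAss_equivariant.
Qed.

Definition coDend_id : coDend 1 := CoDend coDend_id_subproof.

Lemma coDend_idE r c : coDend_id (tens (label K r) c) = pure [tuple c].
Proof. exact: id_funE. Qed.

Definition coDend_operad : operad_data K :=
  OperadData (op_space := fun n => coDend n : lmodType K) coDend_comp coDend_id.

Lemma Phi_subproof n (sigma : coDend n) :
  (fun c => \sum_(r < n) sigma (tens (label K r) c)) \in coAss_pred n.
Proof.
have mL := @tpow_map_linear _ C alpha (linearP alpha) n.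
have m0 : tpow_map alpha 0 = 0 :> tpow C n.
  by have := mL (-1) 0 0; rewrite scaler0 addr0 scaleN1r addNr.
apply/coAss_predP; split=> [a x y|c].
  rewrite scaler_sumr -big_split; apply: eq_bigr => r _ /=.
  by rewrite tens_linear_r coDend_linear.
rewrite (big_morph _ (_ : {morph tpow_map alpha (n := n) : u v / u + v}) m0).
  by apply: eq_bigr => r _; exact: coDend_equivariant.
by move=> u v; have := mL 1 u v; rewrite !scale1r.
Qed.

Definition Phi n (sigma : coDend_operad n) : coAss_operad n :=
  CoAss (Phi_subproof sigma).
End Cochains.

(* Main.v *)
(* Inserting a map at slot i and powers of alpha elsewhere commutes with tensor
   products of blocks, so on a pure tensor both sides of the associativity and
   parallel axioms are the same product of blocks; the exponents of alpha add
   up, and equivariance moves powers of alpha across a cochain. What is left is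
   an identity between the labels R_0[r], R_i[r]. The one non-pointwise case is
   [r] outside the block, where the inner composite is evaluated at
   [1] + ... + [m+n-1]. Since the R_i[r] over each fibre of R_0 sum to
   [1] + ... + [n], this value is the composite of sigma([1] + ... + [m]; -) and
   tau([1] + ... + [n]; -), which also says that Phi preserves compositions. *)
Require Import Defs.
From mathcomp Require Import all_boot all_order all_algebra.
From mathcomp Require Import boolp.
From mathcomp Require Import zify.
Import GRing.Theory.
Local Open Scope ring_scope.

Set Implicit Arguments.
Unset Strict Implicit.
Unset Printing Implicit Defensive.

(** * Tensors of arbitrary degree under concatenation *)

Section TensorAlgebra.
Variables (K : fieldType) (C : lmodType K).

(* Tensors of arbitrary degree: identities between tensors whose degrees are
   equal but not convertible become Leibniz equalities, without casts. *)
Definition tens_alg := {n : nat & tpow C n : Type}.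

Definition in_deg n (u : tpow C n) : tens_alg := Tagged (fun n => tpow C n : Type) u.

Definition gmul (x y : tens_alg) : tens_alg := in_deg (tmul (tagged x) (tagged y)).

(** Indexed by sequences rather than tuples, so that identities between pure tensors become
    identities between lists. *)
Definition gpure (s : seq C) : tens_alg := in_deg (pure (in_tuple s)).

Lemma in_deg_pure n (t : n.-tuple C) : in_deg (pure t) = gpure t.
Proof.
case: t => s sn; move/eqP: (sn) => e; subst n.
by congr (in_deg (pure _)); apply: val_inj.
Qed.

Lemma in_deg_tcast m n (e : m = n) (u : tpow C m) : in_deg (Defs.tcast e u) = in_deg u.
Proof. by case: n / e. Qed.

Lemma in_deg_tmul m n (u : tpow C m) (v : tpow C n) :
  in_deg (tmul u v) = gmul (in_deg u) (in_deg v).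
Proof. by []. Qed.

Lemma in_deg_inj n : injective (@in_deg n).
Proof. by move=> u v; apply: (@eq_from_Tagged nat (fun n => tpow C n : Type)). Qed.

Lemma gpure_cat s t : gmul (gpure s) (gpure t) = gpure (s ++ t).
Proof. by rewrite -[LHS]in_deg_tmul tmul_pure in_deg_pure. Qed.

Lemma in_deg_ext m p q (F : tpow C m -> tpow C p) (G : tpow C m -> tpow C q) :
  p = q -> linear F -> linear G ->
  (forall t, in_deg (F (pure t)) = in_deg (G (pure t))) ->
  forall u, in_deg (F u) = in_deg (G u).
Proof.
move=> e; subst q => lF lG FG u; congr in_deg.
by apply: tpow_ext u => // t; apply: in_deg_inj.
Qed.

Lemma gmulA : associative gmul.
Proof.
move=> [a u] [b v] [c w].
change (in_deg (tmul u (tmul v w)) = in_deg (tmul (tmul u v) w)).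
move: u; apply: in_deg_ext; first exact: addnA.
- by move=> x y z; rewrite tmul_linear_l.
- by move=> x y z; rewrite !tmul_linear_l.
move=> r; move: v; apply: in_deg_ext; first exact: addnA.
- by move=> x y z; rewrite tmul_linear_l tmul_linear_r.
- by move=> x y z; rewrite tmul_linear_r tmul_linear_l.
move=> s; move: w; apply: in_deg_ext; first exact: addnA.
- by move=> x y z; rewrite !tmul_linear_r.
- by move=> x y z; rewrite tmul_linear_r.
by move=> t; rewrite !in_deg_tmul !in_deg_pure !gpure_cat catA.
Qed.

Lemma gmul1g : left_id (gpure [::]) gmul.
Proof.
move=> [n u]; change (in_deg (tmul (pure (in_tuple [::])) u) = in_deg u).
move: u; apply: in_deg_ext => //; first by move=> a x y; rewrite tmul_linear_r.
by move=> t; rewrite in_deg_tmul !in_deg_pure gpure_cat.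
Qed.

Lemma gmulg1 : right_id (gpure [::]) gmul.
Proof.
move=> [n u]; change (in_deg (tmul u (pure (in_tuple [::]))) = in_deg u).
move: u; apply: in_deg_ext => //; first exact: addn0.
  by move=> a x y; rewrite tmul_linear_l.
by move=> t; rewrite in_deg_tmul !in_deg_pure gpure_cat cats0.
Qed.

Lemma tpow_map_id n (u : tpow C n) : tpow_map id u = u.
Proof.
have lid : linear (@id C) by [].
move: u; apply: tpow_ext => //; first exact: tpow_map_linear.
by move=> t; rewrite tpow_map_pure //; congr pure; apply: val_inj; rewrite /= map_id.
Qed.

Lemma tpow_map_comp (f g : C -> C) n (u : tpow C n) : linear f -> linear g ->
  tpow_map (f \o g) u = tpow_map f (tpow_map g u).
Proof.
move=> lf lg; have lfg : linear (f \o g) by move=> a x y /=; rewrite lg lf.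
move: u; apply: tpow_ext => [|a x y|t]; first exact: tpow_map_linear.
  by rewrite (tpow_map_linear lg) (tpow_map_linear lf).
by rewrite !tpow_map_pure //; congr pure; apply: val_inj; rewrite /= map_comp.
Qed.

Lemma gpure_mktuple_take (f : C -> C) m (t : m.-tuple C) (i : nat) : (i <= m)%N ->
  gpure [tuple f t`_j | j < i] = gpure (map f (take i t)).
Proof.
move=> im; congr gpure; apply: (@eq_from_nth _ 0).
  by rewrite size_tuple size_map size_takel ?size_tuple.
move=> j; rewrite size_tuple => ji.
rewrite (nth_mktuple_nat (fun j => f t`_j)) // (nth_map 0) ?nth_take //.
by rewrite size_takel ?size_tuple.
Qed.

Lemma gpure_mktuple_drop (f : C -> C) m (t : m.-tuple C) (i : nat) :
  gpure [tuple f t`_(i + j) | j < m - i] = gpure (map f (drop i t)).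
Proof.
congr gpure; apply: (@eq_from_nth _ 0).
  by rewrite size_tuple size_map size_drop size_tuple.
move=> j; rewrite size_tuple => ji.
rewrite (nth_mktuple_nat (fun j => f t`_(i + j))) // (nth_map 0) ?nth_drop //.
by rewrite size_drop size_tuple.
Qed.

(** * Insertion at one slot of a product of blocks *)

Section Insert.
Variables (f : C -> C) (n : nat) (g : C -> tpow C n).
Hypotheses (lf : linear f) (lg : linear g).

Lemma in_deg_insert_pure m (i : 'I_m) (t : m.-tuple C) :
  in_deg (tpow_insert i f g (pure t)) =
  gmul (gmul (gpure (map f (take i t))) (in_deg (g t`_i)))
       (gpure (map f (drop i.+1 t))).
Proof.
rewrite tpow_insertE // in_deg_tcast !in_deg_tmul !in_deg_pure.
by rewrite gpure_mktuple_take ?gpure_mktuple_drop // ltnW.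
Qed.

Lemma in_deg_map_pure m (t : m.-tuple C) :
  in_deg (tpow_map f (pure t)) = gpure (map f t).
Proof. by rewrite tpow_map_pure // in_deg_pure. Qed.

(** When the slot lies in the left factor, the right factor only receives [f]. The factorization of
    [w] is a hypothesis in [tens_alg] because the degree [m] met in practice, such as [(m + n).-1],
    is not convertible to a sum [a + b]. *)
Lemma in_deg_insert_tmul_l a b m (k : 'I_a) (i : 'I_m)
    (u : tpow C a) (v : tpow C b) (w : tpow C m) :
  i = k :> nat -> in_deg w = gmul (in_deg u) (in_deg v) ->
  in_deg (tpow_insert i f g w) =
  gmul (in_deg (tpow_insert k f g u)) (in_deg (tpow_map f v)).
Proof.
move=> ik wE; have e : m = (a + b)%N by case/(congr1 tag): wE.
subst m; rewrite -[RHS]in_deg_tmul; move: wE; rewrite -in_deg_tmul => /in_deg_inj ->.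
have ka := ltn_ord k.
have arE : ((a + b + n).-1 = (a + n).-1 + b)%N by lia.
move: u {w}; apply: in_deg_ext => //.
- by move=> c x y; rewrite tmul_linear_l (tpow_insert_linear i lf lg).
- by move=> c x y; rewrite (tpow_insert_linear k lf lg) tmul_linear_l.
move=> s; move: v; apply: in_deg_ext => //.
- by move=> c x y; rewrite tmul_linear_r (tpow_insert_linear i lf lg).
- by move=> c x y; rewrite (tpow_map_linear lf) tmul_linear_r.
move=> t; rewrite tmul_pure in_deg_insert_pure in_deg_tmul in_deg_insert_pure.
rewrite in_deg_map_pure -!gmulA gpure_cat -map_cat ik /=.
rewrite take_cat drop_cat nth_cat size_tuple ka.
(* Boundary case: the slot is the last position of the left factor, so nothing of [s] follows it and
   the tail is all of [t]. *)
case: ltnP => // ak; have -> : k.+1 = a by lia.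
by rewrite subnn drop0 drop_oversize ?size_tuple.
Qed.

Lemma in_deg_insert_tmul_r a b m (k : 'I_b) (i : 'I_m)
    (u : tpow C a) (v : tpow C b) (w : tpow C m) :
  i = (a + k)%N :> nat -> in_deg w = gmul (in_deg u) (in_deg v) ->
  in_deg (tpow_insert i f g w) =
  gmul (in_deg (tpow_map f u)) (in_deg (tpow_insert k f g v)).
Proof.
move=> ik wE; have e : m = (a + b)%N by case/(congr1 tag): wE.
subst m; rewrite -[RHS]in_deg_tmul; move: wE; rewrite -in_deg_tmul => /in_deg_inj ->.
have kb := ltn_ord k.
have arE : ((a + b + n).-1 = a + (b + n).-1)%N by lia.
move: u {w}; apply: in_deg_ext => //.
- by move=> c x y; rewrite tmul_linear_l (tpow_insert_linear i lf lg).
- by move=> c x y; rewrite (tpow_map_linear lf) tmul_linear_l.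
move=> s; move: v; apply: in_deg_ext => //.
- by move=> c x y; rewrite tmul_linear_r (tpow_insert_linear i lf lg).
- by move=> c x y; rewrite (tpow_insert_linear k lf lg) tmul_linear_r.
move=> t; rewrite tmul_pure in_deg_insert_pure in_deg_tmul in_deg_insert_pure.
rewrite in_deg_map_pure !gmulA gpure_cat -map_cat ik /=.
rewrite take_cat drop_cat nth_cat size_tuple.
have [-> -> ->] : [/\ (a + k < a)%N = false, ((a + k).+1 < a)%N = false &
  ((a + k).+1 - a = k.+1)%N] by split; lia.
by rewrite addKn.
Qed.
End Insert.

(** Linearity in the inserted map, with the tensor fixed. It gives linearity of composition in its
    second argument and allows sums of labels to pass through an insertion. *)
Lemma tpow_insert_linear_r (f : C -> C) m n (i : 'I_m) a (g g' : C -> tpow C n) u :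
  linear f -> linear g -> linear g' ->
  tpow_insert i f (fun c => a *: g c + g' c) u =
  a *: tpow_insert i f g u + tpow_insert i f g' u.
Proof.
move=> lf lg lg'.
have lgg' : linear (fun c => a *: g c + g' c).
  by move=> b x y; rewrite lg lg' !scalerDr !scalerA (mulrC a) addrACA.
move: u; apply: tpow_ext => [b x y|b x y|t].
- by rewrite (tpow_insert_linear i lf lgg').
- rewrite (tpow_insert_linear i lf lg) (tpow_insert_linear i lf lg').
  by rewrite !scalerDr !scalerA (mulrC a) addrACA.
rewrite (tpow_insertE i lf lgg') (tpow_insertE i lf lg) (tpow_insertE i lf lg').
by rewrite tmul_linear_r tmul_linear_l tcast_linear.
Qed.

(** * Nested and parallel insertions *)

Section InsertTwice.
Variables (A B : C -> C) (m n p : nat).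
Hypotheses (lA : linear A) (lB : linear B).

(** The first insertion gives three blocks, and slot [k] falls in the middle one, at its position
    [j]. The outer blocks, already carrying [A], then receive [B]. *)
Lemma in_deg_insert_assoc (i : 'I_m) (j : 'I_n) (k : 'I_(m + n).-1)
    (g : C -> tpow C n) (h : C -> tpow C p) u :
  k = (i + j)%N :> nat -> linear g -> linear h ->
  in_deg (tpow_insert k B h (tpow_insert i A g u)) =
  in_deg (tpow_insert i (B \o A) (tpow_insert j B h \o g) u).
Proof.
move=> kE lg lh.
have lBA : linear (B \o A) by move=> a x y /=; rewrite lA lB.
have lhg : linear (tpow_insert j B h \o g).
  by move=> a x y /=; rewrite lg (tpow_insert_linear j lB lh).
move: u; apply: in_deg_ext.
- by have := ltn_ord i; have := ltn_ord j; lia.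
- by move=> a x y; rewrite (tpow_insert_linear i lA lg) (tpow_insert_linear k lB lh).
- by move=> a x y; rewrite (tpow_insert_linear i lBA lhg).
move=> t; rewrite (in_deg_insert_pure lBA) //.
pose x := pure (in_tuple (map A (take i t))).
pose y := pure (in_tuple (map A (drop i.+1 t))).
(* Position [j] of the middle block, seen in the product of the first two blocks. *)
pose ij := rshift (size (map A (take i t))) j.
rewrite (in_deg_insert_tmul_l lB lh (k := ij) (u := tmul x (g t`_i)) (v := y));
  last 2 first.
- by rewrite /= size_map size_takel // size_tuple ltnW.
- by rewrite in_deg_insert_pure.
rewrite (in_deg_insert_tmul_r lB lh (k := j) (u := x) (v := g t`_i)) //.
by rewrite !in_deg_map_pure // -!map_comp.
Qed.

(** Slot [j] lies to the right of [i], so the first insertion moves it by [n - 1], whereas slot [i]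
    stays in place when [j] is filled first. The last three hypotheses let [A] and [B] change order
    on the untouched entries and pass through the two inserted maps. *)
Lemma in_deg_insert_parallel (i j : 'I_m) (k : 'I_(m + n).-1) (l : 'I_(m + p).-1)
    (g g' : C -> tpow C n) (h h' : C -> tpow C p) u :
  (0 < n)%N -> (0 < p)%N -> (i < j)%N -> k = (j + n).-1 :> nat -> l = i :> nat ->
  linear g -> linear h -> linear g' -> linear h' ->
  (forall c, A (B c) = B (A c)) ->
  (forall c, tpow_map B (g c) = g' (B c)) ->
  (forall c, tpow_map A (h' c) = h (A c)) ->
  in_deg (tpow_insert k B h (tpow_insert i A g u)) =
  in_deg (tpow_insert l A g' (tpow_insert j B h' u)).
Proof.
move=> n0 p0 ij kE lE lg lh lg' lh' AB gB hA.
move: u; apply: in_deg_ext.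
- by have := ltn_ord j; lia.
- by move=> a x y; rewrite (tpow_insert_linear i lA lg) (tpow_insert_linear k lB lh).
- by move=> a x y; rewrite (tpow_insert_linear j lB lh') (tpow_insert_linear l lA lg').
move=> t.
have ti : size (take i t) = i by rewrite size_takel // size_tuple ltnW.
have tj : size (take j t) = j by rewrite size_takel // size_tuple ltnW.
have jm := ltn_ord j.
have jd : (j - i.+1 < size (map A (drop i.+1 t)))%N.
  by rewrite size_map size_drop size_tuple; lia.
have il : (i < size (map B (take j t)))%N by rewrite size_map tj.
(* The first two blocks have total degree [i + n], so slot [k = j + n - 1] is position [j - i - 1]
   of the third. *)
rewrite (in_deg_insert_tmul_r lB lh (k := Ordinal jd)
  (u := tmul (pure (in_tuple (map A (take i t)))) (g t`_i))
  (v := pure (in_tuple (map A (drop i.+1 t))))); last 2 first.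
- by rewrite /= size_map ti kE; lia.
- by rewrite in_deg_insert_pure.
rewrite (in_deg_insert_tmul_l lA lg' (k := lshift p (Ordinal il))
  (u := tmul (pure (in_tuple (map B (take j t)))) (h' t`_j))
  (v := pure (in_tuple (map B (drop j.+1 t))))); last 2 first.
- by rewrite /= lE.
- by rewrite in_deg_insert_pure.
rewrite (in_deg_insert_tmul_l lA lg' (k := Ordinal il)
  (u := pure (in_tuple (map B (take j t)))) (v := h' t`_j)) //.
rewrite !tpow_map_tmul // !in_deg_tmul !in_deg_insert_pure // !in_deg_map_pure //=.
rewrite gB hA -!gmulA.
have mAB s : map B (map A s) = map A (map B s).
  by rewrite -!map_comp; apply: eq_map => c /=.
have ij' : (i < size (take j t))%N by rewrite tj.
have jd' : (j - i.+1 < size (drop i.+1 t))%N by rewrite -(size_map A).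
(* Five blocks: before [i], the image of entry [i], strictly between, the image of entry [j], after
   [j]. *)
congr (gmul _ (gmul _ (gmul _ (gmul _ _)))).
- by rewrite mAB -!map_take take_takel // ltnW.
- by rewrite (nth_map 0) // nth_take.
- by rewrite -!map_take -!map_drop mAB take_drop subnK.
- by rewrite (nth_map 0) // nth_drop subnKC.
- by rewrite -!map_drop mAB drop_drop addSn subnK.
Qed.
End InsertTwice.
End TensorAlgebra.

(** Stated for the bare predicate [linear], since it is applied to anonymous functions such as
    evaluation of a cochain in one argument. *)
Lemma linear_sum (K : fieldType) (U W : lmodType K) (F : U -> W) : linear F ->
  forall (I : Type) (r : seq I) (P : pred I) (G : I -> U),
  F (\sum_(i <- r | P i) G i) = \sum_(i <- r | P i) F (G i).
Proof.
move=> lF I r P G; apply: (big_morph F) => [x y|].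
  by have := lF 1 x y; rewrite !scale1r.
by have := lF (-1) 0 0; rewrite scaler0 addr0 scaleN1r addNr.
Qed.

(** * Arithmetic of the label maps *)

Section Labels.
Variable K : fieldType.

Lemma sum_label n : \sum_(s < n) label K s = const_mx 1.
Proof.
apply/rowP => j; rewrite summxE mxE (bigD1 j) //= big1 ?mxE ?eqxx ?addr0 //.
by move=> s sj; rewrite mxE eq_sym (negbTE sj) andbF.
Qed.

(** Off the block the implication is vacuous and yields the all-ones row. With this uniform formula,
    equalities between label vectors become boolean arithmetic. *)
Lemma RiE m n (i : 'I_m) (r : 'I_(m + n).-1) :
  Ri K n i r = \row_s ((i <= r < i + n)%N ==> (r == i + s :> nat)%N)%:R.
Proof.
apply/rowP => s; rewrite /Ri mxE; case: {-}_ / idP => [ir|/negP ir].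
  rewrite ir mxE /= -val_eqE /=; congr (nat_of_bool _)%:R.
  by move: ir; lia.
by rewrite (negbTE ir) sum_label mxE.
Qed.

Lemma Ri_block m n (i : 'I_m) (r : 'I_(m + n).-1) (s : 'I_n) :
  r = (i + s)%N :> nat -> Ri K n i r = label K s.
Proof.
move=> rE; apply/rowP => j; rewrite RiE !mxE /= -val_eqE /=.
congr (nat_of_bool _)%:R; have := ltn_ord s; move: rE; lia.
Qed.

Lemma Ri_off_block m n (i : 'I_m) (r : 'I_(m + n).-1) :
  ~~ (i <= r < i + n)%N -> Ri K n i r = \sum_(s < n) label K s.
Proof. by move=> ir; apply/rowP => j; rewrite RiE sum_label !mxE (negbTE ir). Qed.

Lemma R0_cases m n (i : 'I_m) (r : 'I_(m + n).-1) :
  (r < i)%N /\ R0 n i r = r :> nat \/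
  (i <= r < i + n)%N /\ R0 n i r = i :> nat \/
  (i + n <= r)%N /\ (R0 n i r + n.-1)%N = r :> nat.
Proof.
by rewrite /=; case: (ltnP r i) => ?; [|case: (ltnP r (i + n)) => ?]; lia.
Qed.

(** For [q] different from [i] the fibre is a single label off the block; for [q = i] it is the
    block, on which [Ri] runs through the basis. Either way, each coordinate [s] is 1 at exactly one
    member of the fibre. *)
Lemma sum_Ri_fiber m n (i q : 'I_m) :
  \sum_(r < (m + n).-1 | R0 n i r == q) Ri K n i r = \sum_(s < n) label K s.
Proof.
apply/rowP => s; rewrite sum_label summxE mxE.
have sn := ltn_ord s; have qm := ltn_ord q; have im := ltn_ord i.
(* [v] is the only label of the fibre whose [s]-th coordinate is nonzero. *)
have [v [vl ve vg]] : exists v : nat, [/\ (q < i)%N -> v = q,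
    q = i :> nat -> v = (i + s)%N & (i < q)%N -> v = (q + n.-1)%N].
  by case: (ltngtP q i) => qi; [exists q | exists (q + n.-1)%N | exists (i + s)%N];
    split=> // ?; lia.
have vlt : (v < (m + n).-1)%N by case: (ltngtP q i) => ?; lia.
rewrite (bigD1 (Ordinal vlt)) /=; last first.
  have vE : Ordinal vlt = v :> nat by [].
  by apply/eqP/ord_inj; have := R0_cases i (Ordinal vlt); lia.
rewrite RiE mxE /= big1 ?addr0.
  by have -> : (i <= v < i + n)%N ==> (v == i + s)%N by lia.
move=> r /andP[]; rewrite RiE mxE -!val_eqE /= => /eqP rq rv.
have -> // : (i <= r < i + n)%N ==> (r == i + s :> nat)%N = false.
by have := R0_cases i r; have := ltn_ord r; move: rq rv => /=; lia.
Qed.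
End Labels.

(** * Composition of dendriform cochains and the operad axioms *)

Section CoDendOperad.
Variables (K : fieldType) (C : lmodType K) (alpha : {linear C -> C}).
Local Notation coDend := (coDend alpha).
Local Notation aiter n := (iter n alpha).

Lemma coDend_linear_l n (sigma : coDend n) c : linear (fun x => sigma (tens x c)).
Proof. by move=> a x y; rewrite tens_linear_l (coDend_linear sigma). Qed.

Lemma coDend_linear_r n (sigma : coDend n) x : linear (fun c => sigma (tens x c)).
Proof. by move=> a c d; rewrite tens_linear_r (coDend_linear sigma). Qed.

Lemma coDend_valP n a (s t : coDend n) z : (a *: s + t) z = a *: s z + t z.
Proof. by []. Qed.

Lemma coDend_ext n (s t : coDend n) :
  (forall r c, s (tens (label K r) c) = t (tens (label K r) c)) -> s = t.
Proof.
move=> st; apply: val_inj; apply: funext => z /=.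
move: z; apply: tensor_ind => [|a x y sx sy|x c].
- have s0 (u : coDend n) : u 0 = 0.
    have := coDend_linear u (-1) 0 0.
    by rewrite scaler0 addr0 scaleN1r addNr.
  by rewrite !s0.
- by rewrite (coDend_linear s) (coDend_linear t) sx sy.
have E (u : coDend n) : u (tens x c) = \sum_r x 0 r *: u (tens (label K r) c).
  rewrite [x in LHS]row_sum_delta (linear_sum (coDend_linear_l u c)).
  apply: eq_bigr => r _.
  have := coDend_linear_l u c (x 0 r) (label K r) 0.
  have := coDend_linear_l u c (-1) 0 0.
  by rewrite scaler0 addr0 scaleN1r addNr => -> ; rewrite !addr0.
by rewrite !E; apply: eq_bigr => r _; rewrite st.
Qed.

(** The labels on the two sides have different ordinal types and are matched by value; [in_deg] does
    the same for the degrees of the results. *)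
Lemma coDend_op_eq m n (s : coDend m) (t : coDend n) : m = n ->
  (forall (r : 'I_m) (q : 'I_n) c, r = q :> nat ->
     in_deg (s (tens (label K r) c)) = in_deg (t (tens (label K q) c))) ->
  op_eq (coDend_operad alpha) s t.
Proof.
move=> e; subst n => st; rewrite /op_eq; congr existT.
by apply: coDend_ext => r c; apply: in_deg_inj; apply: st.
Qed.

(** Group the labels by their image under [R0]: on each fibre the value of [s] is constant, and the
    arguments of [t] add up to the sum of all labels by [sum_Ri_fiber]. *)
Lemma coDend_comp_sum m n (i : 'I_m) (s : coDend m) (t : coDend n) c :
  coDend_comp i s t (tens (\sum_r label K r) c) =
  tpow_insert i (aiter n.-1) (fun d => t (tens (\sum_r label K r) d))
    (s (tens (\sum_r label K r) c)).
Proof.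
have lit x := tpow_insert_linear i (iter_linear alpha n.-1) (coDend_linear_r t x).
rewrite !(linear_sum (coDend_linear_l _ c)) (linear_sum (lit _)).
rewrite (partition_big (R0 n i) xpredT) //=; apply: eq_bigr => q _.
(* Linearity in the label vector fed to [t], which brings the sum over the fibre inside the
   insertion. *)
have lt : linear (fun x => tpow_insert i (aiter n.-1) (fun d => t (tens x d))
    (s (tens (label K q) c))).
  move=> a x y; rewrite -tpow_insert_linear_r; first congr tpow_insert.
  - by apply: funext => d; rewrite tens_linear_l (coDend_linear t).
  - exact: iter_linear.
  - exact: coDend_linear_r.
  - exact: coDend_linear_r.
rewrite -(sum_Ri_fiber K n i q) (linear_sum lt); apply: eq_bigr => r /eqP <-.
exact: coDend_compE.
Qed.

(** The inner half of associativity. On the large block everything is translated by [i], and the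
    composite is evaluated at one label. Off it, all three label vectors are full sums and
    [coDend_comp_sum] applies. *)
Lemma coDend_comp_Ri m n p (i : 'I_m) (j : 'I_n) (k : 'I_(m + n).-1)
    (r : 'I_((m + n).-1 + p).-1) (q : 'I_(m + (n + p).-1).-1)
    (g : coDend n) (h : coDend p) c :
  (0 < p)%N -> k = (i + j)%N :> nat -> r = q :> nat ->
  coDend_comp j g h (tens (Ri K _ i q) c) =
  tpow_insert j (aiter p.-1) (fun d => h (tens (Ri K _ k r) d))
    (g (tens (Ri K _ i (R0 p k r)) c)).
Proof.
move=> p0 kE rq; have jn := ltn_ord j; have im := ltn_ord i.
have [iq|iq] := boolP (i <= q < i + (n + p).-1)%N.
  have slt : (q - i < (n + p).-1)%N by lia.
  rewrite (Ri_block K (s := Ordinal slt)); last by rewrite /=; lia.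
  rewrite coDend_compE.
  have -> : Ri K p j (Ordinal slt) = Ri K p k r.
    by apply/rowP => s; rewrite !RiE !mxE /=; congr (nat_of_bool _)%:R; lia.
  rewrite (Ri_block K (r := R0 p k r) (s := R0 p j (Ordinal slt))) //.
  by move: (R0_cases k r) (R0_cases j (Ordinal slt)) => /=; lia.
rewrite Ri_off_block // coDend_comp_sum.
rewrite (Ri_off_block K (r := R0 p k r)); last first.
  by move: (R0_cases k r) (ltn_ord r); lia.
by rewrite (Ri_off_block K (r := r)) // rq kE; lia.
Qed.

Lemma coDend_comp_linear_l m n (i : 'I_m) (t : coDend n) :
  linear (fun s : coDend m => coDend_comp i s t).
Proof.
move=> a s s'; apply: coDend_ext => r c; rewrite coDend_valP !coDend_compE.
by rewrite coDend_valP (tpow_insert_linear i (iter_linear alpha n.-1) (coDend_linear_r t _)).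
Qed.

Lemma coDend_comp_linear_r m n (i : 'I_m) (s : coDend m) :
  linear (fun t : coDend n => coDend_comp i s t).
Proof.
move=> a t t'; apply: coDend_ext => r c; rewrite coDend_valP !coDend_compE.
rewrite -tpow_insert_linear_r //; first exact: iter_linear.
- exact: coDend_linear_r.
- exact: coDend_linear_r.
Qed.

Lemma coDend_comp_assoc m n p (i : 'I_m) (j : 'I_n) (k : 'I_(m + n).-1)
    (f : coDend m) (g : coDend n) (h : coDend p) :
  (0 < p)%N -> k = (i + j)%N :> nat ->
  op_eq (coDend_operad alpha) (coDend_comp k (coDend_comp i f g) h)
    (coDend_comp i f (coDend_comp j g h)).
Proof.
move=> p0 kE; have jn := ltn_ord j; have im := ltn_ord i.
apply: coDend_op_eq => [|r q c rq]; first by lia.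
(* Both arities are positive, [n] because of [j], so the truncated predecessors add up correctly. *)
have fE : aiter p.-1 \o aiter n.-1 = aiter (n + p).-1.-1.
  by apply: funext => x /=; rewrite -iterD; congr iter; lia.
rewrite !coDend_compE (in_deg_insert_assoc (iter_linear _ _) (iter_linear _ _) _ kE
  (coDend_linear_r _ _) (coDend_linear_r _ _)).
(* Collapsing the inner block and then the block around it amounts to collapsing the large block at
   once. *)
have -> : R0 n i (R0 p k r) = R0 (n + p).-1 i q.
  apply: ord_inj; move: (R0_cases k r) (R0_cases i (R0 p k r)) (R0_cases i q).
  lia.
rewrite fE; congr (in_deg (tpow_insert _ _ _ _)); apply: funext => d.
by rewrite /comp (coDend_comp_Ri (k := k) (r := r)).
Qed.

Lemma coDend_iter_equivariant n (s : coDend n) x b c :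
  tpow_map (aiter b) (s (tens x c)) = s (tens x (aiter b c)).
Proof.
elim: b c => [|b IH] c; first exact: tpow_map_id.
rewrite -[aiter b.+1]/(alpha \o aiter b) tpow_map_comp ?IH ?coDend_equivariant //.
  exact: linearP.
exact: iter_linear.
Qed.

Lemma coDend_comp_parallel m n p (i j : 'I_m)
    (k : 'I_(m + n).-1) (l : 'I_(m + p).-1)
    (f : coDend m) (g : coDend n) (h : coDend p) :
  (0 < n)%N -> (0 < p)%N -> (i < j)%N ->
  k = (j + n).-1 :> nat -> l = i :> nat ->
  op_eq (coDend_operad alpha) (coDend_comp k (coDend_comp i f g) h)
    (coDend_comp l (coDend_comp j f h) g).
Proof.
move=> n0 p0 ij kE lE; have jm := ltn_ord j.
apply: coDend_op_eq => [|r q c rq]; first by lia.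
rewrite !coDend_compE.
(* The block collapsed by [R0 p k] starts at or after [i + n], so the block of [g] is unaffected. *)
have gR : Ri K n i (R0 p k r) = Ri K n l q.
  apply/rowP => s; rewrite !RiE !mxE; congr (nat_of_bool _)%:R.
  by move: (R0_cases k r); lia.
(* Labels beyond the block of [g] are lowered by [n - 1], which carries the block at [k] to the
   block at [j]. *)
have hR : Ri K p k r = Ri K p j (R0 n l q).
  apply/rowP => s; rewrite !RiE !mxE; congr (nat_of_bool _)%:R.
  by move: (R0_cases l q); lia.
have fR : R0 n i (R0 p k r) = R0 p j (R0 n l q).
  apply: ord_inj; move: (R0_cases k r) (R0_cases i (R0 p k r)).
  by move: (R0_cases l q) (R0_cases j (R0 n l q)); lia.
rewrite fR gR hR; apply: in_deg_insert_parallel => //.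
- exact: iter_linear.
- exact: iter_linear.
- exact: coDend_linear_r.
- exact: coDend_linear_r.
- exact: coDend_linear_r.
- exact: coDend_linear_r.
- by move=> d; rewrite -!iterD addnC.
- by move=> d; apply: coDend_iter_equivariant.
- by move=> d; apply: coDend_iter_equivariant.
Qed.

Lemma coDend_comp_idr m (i : 'I_m) (f : coDend m) :
  op_eq (coDend_operad alpha) (coDend_comp i f (coDend_id alpha)) f.
Proof.
have im := ltn_ord i.
apply: coDend_op_eq => [|r q c rq]; first by lia.
rewrite coDend_compE.
have -> : R0 1 i r = q by apply: ord_inj; move: (R0_cases i r); lia.
(* In arity 1 the sum of all labels is the single label, so both branches of [Ri] agree. *)
have -> : Ri K 1 i r = label K ord0.
  apply/rowP => s; rewrite RiE !mxE [s]ord1 !eqxx.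
  by have -> : (i <= r < i + 1)%N ==> (r == i + 0%N :> nat)%N by lia.
move: (f _); apply: in_deg_ext => //; first by lia.
  by apply: tpow_insert_linear; [exact: iter_linear | exact: coDend_linear_r].
move=> t; rewrite in_deg_insert_pure; [|exact: iter_linear|exact: coDend_linear_r].
rewrite coDend_idE !in_deg_pure /= !map_id !gpure_cat.
by rewrite -catA cat1s -drop_nth ?size_tuple // cat_take_drop.
Qed.

Lemma coDend_comp_idl n (f : coDend n) : (0 < n)%N ->
  op_eq (coDend_operad alpha) (coDend_comp ord0 (coDend_id alpha) f) f.
Proof.
move=> n0; apply: coDend_op_eq => [|r q c rq]; first by lia.
rewrite coDend_compE coDend_idE in_deg_insert_pure;
  [|exact: iter_linear|exact: coDend_linear_r].
(* With [m = 1] the outer blocks are empty and every label lies in the block. *)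
rewrite gmul1g gmulg1; congr (in_deg (f (tens _ _))).
by apply: Ri_block.
Qed.

(** * The morphism to coassociative cochains *)

Lemma Phi_linear n : linear (@Phi K C alpha n).
Proof.
move=> a s t; apply: val_inj; apply: funext => c.
change (\sum_(r < n) (a *: s (tens (label K r) c) + t (tens (label K r) c)) =
  a *: (\sum_(r < n) s (tens (label K r) c)) + \sum_(r < n) t (tens (label K r) c)).
by rewrite scaler_sumr big_split.
Qed.

(** By linearity [Phi] is evaluation at the sum of all labels, so this is [coDend_comp_sum]. *)
Lemma Phi_comp m n (i : 'I_m) (f : coDend m) (g : coDend n) :
  Phi (coDend_comp i f g) = coAss_comp i (Phi f) (Phi g).
Proof.
apply: val_inj; apply: funext => c.
change (\sum_r coDend_comp i f g (tens (label K r) c) =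
  tpow_insert i (aiter n.-1) (fun d => \sum_r g (tens (label K r) d))
    (\sum_r f (tens (label K r) c))).
rewrite -(linear_sum (coDend_linear_l _ c)) coDend_comp_sum.
rewrite -(linear_sum (coDend_linear_l f c)); congr tpow_insert.
by apply: funext => d; rewrite -(linear_sum (coDend_linear_l g d)).
Qed.
End CoDendOperad.

Theorem theorem5p3 (K : fieldType) (charK : [pchar K] =i pred0)
    (C : lmodType K) (alpha : {linear C -> C}) :
  is_operad (coDend_operad alpha) /\
  is_operad_morphism (coDend_operad alpha) (coAss_operad alpha) (@Phi K C alpha).
Proof.
split; split.
- by move=> m n i g _; exact: coDend_comp_linear_l.
- by move=> m n i f _; exact: coDend_comp_linear_r.
- exact: coDend_comp_assoc.
- exact: coDend_comp_parallel.
- exact: coDend_comp_idr.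
- exact: coDend_comp_idl.
- by move=> n _; exact: Phi_linear.
- by move=> m n i f g _; exact: Phi_comp.
apply: val_inj; apply: funext => c.
change (\sum_(r < 1) coDend_id alpha (tens (label K r) c) = pure [tuple c]).
by rewrite big_ord1 coDend_idE.
Qed.
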